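(* Let $L \ge 1$, let $n_0, n_1, \dots, n_L$ be positive integers, and let $z \in \mathbb{R}^{n_0}$ be fixed. For $i = 1, \dots, L$ let $G_i \subseteq \mathbb{R}^{n_i \times n_{i-1}}$, $B_i \subseteq \mathbb{R}^{n_i}$ and $\sigma_i : \mathbb{R}^{n_i} \to \mathbb{R}^{n_i}$. Put $\Theta = G_L \times B_L \times \cdots \times G_1 \times B_1$ and $X = \mathbb{R}^{n_L}$, and let $\varphi : \Theta \to X$ be the neural network with $L$ layers and fixed input $z$, i.e., for $\theta = (\Gamma_L, b_L, \dots, \Gamma_1, b_1) \in \Theta$, $$\varphi(\theta) = (\sigma_L \circ \mathcal{K}_L \circ \cdots \circ \sigma_2 \circ \mathcal{K}_2 \circ \sigma_1 \circ \mathcal{K}_1)(z), \qquad \mathcal{K}_i(x) := \Gamma_i x + b_i .$$ If $\Theta$ is a compact set and the activation functions $\sigma_1, \dots, \sigma_L$ are valid, then the range $\{\varphi(\theta) : \theta \in \Theta\}$ of $\varphi$ is a closed subset of $X$.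
   Context: An activation function $\sigma : \mathbb{R}^n \to \mathbb{R}^n$ is called valid if it is continuous, monotone (with respect to the componentwise order on $\mathbb{R}^n$), and bounded in the sense that there exists $c > 0$ such that $\|\sigma(x)\| \le c \|x\|$ for all $x \in \mathbb{R}^n$. The set $\Theta$ carries the topology of a subset of the finite-dimensional space $\mathbb{R}^{n_L \times n_{L-1}} \times \mathbb{R}^{n_L} \times \cdots \times \mathbb{R}^{n_1 \times n_0} \times \mathbb{R}^{n_1}$. The input $z$ is fixed, so the network is viewed as a function of its parameters $\theta$ only. *)

(* Defs.v *)
From mathcomp Require Import all_boot all_order all_algebra.
From mathcomp Require Import all_classical all_reals all_analysis.

Set Implicit Arguments.
Unset Strict Implicit.
Unset Printing Implicit Defensive.

Import Order.TTheory GRing.Theory Num.Theory.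
Import numFieldNormedType.Exports.

Local Open Scope classical_set_scope.
Local Open Scope ring_scope.

(* The library norm on ['cV[R]_m] is the maximum norm. *)
Definition euclidean_norm (R : realType) (m : nat) (x : 'cV[R]_m) : R :=
  Num.sqrt (\sum_(j < m) x j ord0 ^+ 2).

Definition cv_le (R : realType) (m : nat) (x y : 'cV[R]_m) : Prop :=
  forall j : 'I_m, x j ord0 <= y j ord0.

Definition valid_activation (R : realType) (m : nat)
    (sigma : 'cV[R]_m -> 'cV[R]_m) : Prop :=
  [/\ continuous sigma,
      forall x y : 'cV[R]_m, cv_le x y -> cv_le (sigma x) (sigma y)
    & exists2 c : R, 0 < c &
        forall x : 'cV[R]_m,
          euclidean_norm (sigma x) <= c * euclidean_norm x].

(* Layers are numbered from 0: [i : 'I_L] stands for layer i + 1, which maps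
   R^(n i) to R^(n i.+1). Only the values of [n] on 0, ..., L are used. The
   space of all pairs (weight, bias), one per layer, has the product topology. *)
Definition parameter_space (R : realType) (L : nat) (n : nat -> nat) : Type :=
  prod_topology
    (fun i : 'I_L => ('M[R]_(n i.+1, n i) * 'cV[R]_(n i.+1))%type).

Definition parameter_set (R : realType) (L : nat) (n : nat -> nat)
    (G : forall i : 'I_L, set 'M[R]_(n i.+1, n i))
    (B : forall i : 'I_L, set 'cV[R]_(n i.+1)) :
    set (parameter_space R L n) :=
  [set theta | forall i : 'I_L, (G i `*` B i) (theta i)].

Definition affine_map (R : realType) (p q : nat)
    (Gb : 'M[R]_(p, q) * 'cV[R]_p) (x : 'cV[R]_q) : 'cV[R]_p :=
  Gb.1 *m x + Gb.2.

(* Output of the first k layers; [k.+1 <= L] is definitionally [k < L]. *)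
Fixpoint network_upto (R : realType) (L : nat) (n : nat -> nat)
    (sigma : forall i : 'I_L, 'cV[R]_(n i.+1) -> 'cV[R]_(n i.+1))
    (z : 'cV[R]_(n 0%N)) (theta : parameter_space R L n) (k : nat) :
    (k <= L)%N -> 'cV[R]_(n k) :=
  match k return (k <= L)%N -> 'cV[R]_(n k) with
  | 0%N => fun _ => z
  | k'.+1 => fun ltkL : (k' < L)%N =>
      let i := Ordinal ltkL in
      sigma i (affine_map (theta i)
                 (network_upto sigma z theta (ltnW ltkL)))
  end.

Definition network (R : realType) (L : nat) (n : nat -> nat)
    (sigma : forall i : 'I_L, 'cV[R]_(n i.+1) -> 'cV[R]_(n i.+1))
    (z : 'cV[R]_(n 0%N)) (theta : parameter_space R L n) : 'cV[R]_(n L) :=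
  network_upto sigma z theta (leqnn L).

(* Main.v *)
(** Matrix-vector multiplication is jointly continuous in its two arguments, so
    by induction on the layers the output of the network depends continuously on
    its parameters. The range is then a compact subset of a Hausdorff space. *)

Require Import Defs.
From mathcomp Require Import all_boot all_order all_algebra.
From mathcomp Require Import all_classical all_reals all_analysis.
Import Order.TTheory GRing.Theory Num.Theory.
Import numFieldNormedType.Exports.
Local Open Scope classical_set_scope.
Local Open Scope ring_scope.

(** A neighbourhood of [M] contains a product of neighbourhoods [P i j] of its entries. There are
    finitely many entries, so the filter meets all these conditions at once. *)
Lemma cvg_mx_coord (U : topologicalType) (p q : nat) (T : Type)
    (F : set_system T) {FF : Filter F}
    (f : T -> 'M[U]_(p, q)) (M : 'M[U]_(p, q)) :
  (forall i j, f x i j @[x --> F] --> M i j) -> f @ F --> M.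
Proof.
move=> fM A [P MP PA]; apply: (@filterS _ F _ _ _ (fun x => PA (f x))).
by apply: filter_forall => i; apply: filter_forall => j; apply: fM; apply: MP.
Qed.

(** Weights, bias and input all vary together, since in a network the input of a layer also depends
    on the parameters. *)
Lemma cvg_affine_map {R : realType} {p q : nat} {T : Type}
    {F : set_system T} {FF : Filter F}
    {f : T -> 'M[R]_(p, q) * 'cV[R]_p} {g : T -> 'cV[R]_q}
    {Gb : 'M[R]_(p, q) * 'cV[R]_p} {x : 'cV[R]_q} :
  f @ F --> Gb -> g @ F --> x ->
  affine_map (f t) (g t) @[t --> F] --> affine_map Gb x.
Proof.
move=> fGb gx.
have fG : (f t).1 @[t --> F] --> Gb.1 by apply: cvg_comp fGb _; exact: cvg_fst.
have fb : (f t).2 @[t --> F] --> Gb.2 by apply: cvg_comp fGb _; exact: cvg_snd.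
apply: cvgD fb; apply: cvg_mx_coord => i j.
under eq_fun do rewrite mxE.
(* Each entry of the product is a finite sum of products of scalar entries, so limits in [R]
   suffice. *)
rewrite mxE; apply: cvg_big => [|k _]; first exact: add_continuous.
apply: cvgM.
- exact: (cvg_comp _ _ fG (@coord_continuous _ _ _ i k _)).
- exact: (cvg_comp _ _ gx (@coord_continuous _ _ _ k j _)).
Qed.

Lemma continuous_network_upto (R : realType) (L : nat) (n : nat -> nat)
    (sigma : forall i : 'I_L, 'cV[R]_(n i.+1) -> 'cV[R]_(n i.+1))
    (z : 'cV[R]_(n 0%N)) (k : nat) (lekL : (k <= L)%N) :
  (forall i, continuous (sigma i)) ->
  continuous
    (fun theta : parameter_space R L n => network_upto sigma z theta lekL).
Proof.
move=> sigma_cont; elim: k lekL => [|k IHk] lekL theta.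
  exact: cst_continuous.
(* The pair [theta i] is a coordinate projection, continuous for the product topology; the layer's
   input is continuous by induction. *)
have affine_cvg := cvg_affine_map (FF := nbhs_filter theta)
  (@proj_continuous _ _ (Ordinal lekL) theta) (IHk (ltnW lekL) theta).
exact: (cvg_comp _ _ affine_cvg (sigma_cont (Ordinal lekL) _)).
Qed.

Theorem lemma1 (R : realType) (L : nat) (hL : (1 <= L)%N)
    (n : nat -> nat) (hn : forall k : nat, (k <= L)%N -> (0 < n k)%N)
    (z : 'cV[R]_(n 0%N))
    (G : forall i : 'I_L, set 'M[R]_(n i.+1, n i))
    (B : forall i : 'I_L, set 'cV[R]_(n i.+1))
    (sigma : forall i : 'I_L, 'cV[R]_(n i.+1) -> 'cV[R]_(n i.+1)) :
  compact (parameter_set G B) ->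
  (forall i : 'I_L, valid_activation (sigma i)) ->
  closed (network sigma z @` parameter_set G B).
Proof.
move=> compactGB sigma_valid; apply: compact_closed; first exact: norm_hausdorff.
(* Continuity on the whole parameter space restricts to the subspace [parameter_set G B]. *)
apply: continuous_compact compactGB; apply: continuous_subspaceT.
by apply: continuous_network_upto => i; case: (sigma_valid i).
Qed.
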